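(* Let $G=(\mathcal H,\mathcal V)$ be a two-dimensional graph on a finite vertex set, with adjacency matrices $H$ and $V$, and let $X_G$ be the two-dimensional shift space generated by $G$. Suppose that for all vertices $i,j$ one has $(HV)_{ij}\neq 0 \Leftrightarrow (VH)_{ij}\neq 0$. If the one-dimensional shift space $X_H$ (or $X_V$) is weakly mixing, then $X_G$ is weakly mixing.
   Context: A two-dimensional graph $G=(\mathcal H,\mathcal V)$ is a pair of finite directed graphs (loops allowed, no multiple edges) on a common vertex set $A$, with $0$-$1$ adjacency matrices $H$ (for $\mathcal H$) and $V$ (for $\mathcal V$). It generates $X_G=\{x\in A^{\mathbb Z^2}: H_{x(m,n)\,x(m+1,n)}=1 \text{ and } V_{x(m,n)\,x(m,n+1)}=1 \text{ for all } (m,n)\in\mathbb Z^2\}$, with the subspace topology of the product topology on $A^{\mathbb Z^2}$ ($A$ discrete). For a $0$-$1$ matrix $M$ indexed by $A$, $X_M=\{x\in A^{\mathbb Z}: M_{x(m)x(m+1)}=1 \text{ for all } m\in\mathbb Z\}$ is the one-dimensional shift of bi-infinite walks. Shift spaces (subshifts) are by definition non-empty, closed and shift-invariant. For $a\in\mathbb Z^d$, $(\sigma^a x)(k)=x(k+a)$. A subshift $X\subseteq A^{\mathbb Z^d}$ is weakly mixing if for any non-empty open sets $U_1,U_2,W_1,W_2\subseteq X$ there is $n\in\mathbb Z^d$ with $\sigma^n(U_i)\cap W_i\neq\emptyset$ for $i=1,2$. *)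

(* Defs.v *)
From mathcomp Require Import all_boot all_order all_algebra.
From mathcomp Require Import all_classical topology.

Set Implicit Arguments.
Unset Strict Implicit.
Unset Printing Implicit Defensive.

Import GRing.Theory.

Local Open Scope classical_set_scope.
Local Open Scope ring_scope.

(* A^K with the product topology, A being discrete.  The index group K stands
   for Z^d: it is used below with K = int and K = int * int. *)
Notation config A K := {ptws K -> discrete_topology A}.

Definition shift (A : finType) (K : zmodType) (a : K) (x : config A K) :
  config A K := fun k => x (k + a).

Definition is_subshift (A : finType) (K : zmodType) (X : set (config A K)) :=
  [/\ X !=set0, closed X & forall a : K, shift a @` X = X].

(* The topology of [subspace X] makes every point outside X isolated, hence the
   inclusion U `<=` X: together the two conjuncts say that U is a subset of X
   that is open for the topology induced on X. *)
Definition open_in (T : topologicalType) (X U : set T) : Prop :=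
  U `<=` X /\ open (U : set (subspace X)).

(* The same n has to serve both pairs (U1, W1) and (U2, W2). *)
Definition weakly_mixing (A : finType) (K : zmodType) (X : set (config A K)) :=
  forall U1 U2 W1 W2 : set (config A K),
    open_in X U1 -> open_in X U2 -> open_in X W1 -> open_in X W2 ->
    U1 !=set0 -> U2 !=set0 -> W1 !=set0 -> W2 !=set0 ->
    exists n : K, (shift n @` U1) `&` W1 !=set0 /\
                  (shift n @` U2) `&` W2 !=set0.

(* MathComp matrices are indexed by ordinals, so a matrix indexed by A is
   indexed by the ranks of the elements of A. *)
Definition entry (A : finType) (M : 'M[int]_#|A|) (i j : A) : int :=
  M (enum_rank i) (enum_rank j).

Definition adjmx (A : finType) (e : rel A) : 'M[int]_#|A| :=
  \matrix_(i, j) (e (enum_val i) (enum_val j))%:R.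

Record graph2 (A : finType) := Graph2 { hedge : rel A; vedge : rel A }.

Definition hmx (A : finType) (G : graph2 A) := adjmx (hedge G).
Definition vmx (A : finType) (G : graph2 A) := adjmx (vedge G).

Definition shift1 (A : finType) (M : 'M[int]_#|A|) : set (config A int) :=
  [set x | forall m : int, entry M (x m) (x (m + 1)) = 1].

Definition shift2 (A : finType) (G : graph2 A) : set (config A (int * int)%type) :=
  [set x | forall m n : int,
    entry (hmx G) (x (m, n)) (x (m + 1, n)) = 1 /\
    entry (vmx G) (x (m, n)) (x (m, n + 1)) = 1].

Lemma entry_adjmx (A : finType) (e : rel A) (i j : A) :
  entry (adjmx e) i j = (e i j)%:R.
Proof. by rewrite /entry mxE !enum_rankK. Qed.

Lemma config_eval_closed (A : finType) (K : zmodType) (k : K) (S : set A) :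
  closed [set x : config A K | S (x k)].
Proof.
have : continuous (proj k : config A K -> discrete_topology A).
  exact: proj_continuous.
by move/continuous_closedP/(_ S); apply; exact: discrete_closed.
Qed.

Lemma closed_pair (A : finType) (K : zmodType) (R : A -> A -> Prop) (k l : K) :
  closed [set x : config A K | R (x k) (x l)].
Proof.
have -> : [set x : config A K | R (x k) (x l)] =
  \bigcap_(a in [set: A]) ([set x | (~` [set a]) (x k)] `|` [set x | R a (x l)]).
  apply/seteqP; split => [x /= Rx a _|x /= Rx].
    by have [<-|na] := pselect (x k = a); [right|left].
  by case: (Rx (x k) I) => //= /(_ erefl).
apply: closed_bigI => a _.
apply: closedU.
  exact: (@config_eval_closed A K k (~` [set a])).
exact: (@config_eval_closed A K l [set b | R a b]).
Qed.

Lemma shift_image (A : finType) (K : zmodType) (X : set (config A K)) :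
  (forall a x, X x -> X (shift a x)) -> forall a, shift a @` X = X.
Proof.
move=> Xs a; apply/seteqP; split => [_ [x Xx <-]|x Xx]; first exact: Xs.
exists (shift (- a) x); first exact: Xs.
by apply/funext => k; rewrite /shift addrK.
Qed.

(* Closedness and invariance are automatic: only non-emptiness is a condition. *)
Lemma is_subshift_shift1 (A : finType) (M : 'M[int]_#|A|) :
  is_subshift (shift1 M) <-> shift1 M !=set0.
Proof.
split=> [[]//|ne]; split=> //.
  have -> : shift1 M = \bigcap_(m in [set: int])
      [set x : config A int | entry M (x m) (x (m + 1)) = 1].
    by apply/seteqP; split => x /= Hx m; [move=> _; exact: Hx|exact: (Hx m I)].
  apply: closed_bigI => m _.
  exact: (@closed_pair A _ (fun a b => entry M a b = 1)).
by apply: shift_image => a x Xx m; rewrite /shift addrAC; exact: Xx.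
Qed.

Lemma is_subshift_shift2 (A : finType) (G : graph2 A) :
  is_subshift (shift2 G) <-> shift2 G !=set0.
Proof.
split=> [[]//|ne]; split=> //.
  have -> : shift2 G = \bigcap_(p in [set: int * int])
      ([set x : config A (int * int)%type |
          entry (hmx G) (x (p.1, p.2)) (x (p.1 + 1, p.2)) = 1] `&`
       [set x : config A (int * int)%type |
          entry (vmx G) (x (p.1, p.2)) (x (p.1, p.2 + 1)) = 1]).
    apply/seteqP; split => x /= Hx; first by move=> [m n] _; exact: Hx.
    by move=> m n; exact: (Hx (m, n) I).
  apply: closed_bigI => p _; apply: closedI.
    exact: (@closed_pair A _ (fun a b => entry (hmx G) a b = 1)).
  exact: (@closed_pair A _ (fun a b => entry (vmx G) a b = 1)).
apply: shift_image => -[a b] x Xx m n.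
have := Xx (m + a) (n + b); rewrite /shift.
by rewrite -(addrAC m 1 a) -(addrAC n 1 b).
Qed.

(* Main.v *)
Require Import Defs.
From mathcomp Require Import all_boot all_order all_algebra.
From mathcomp Require Import all_classical topology.
From mathcomp Require Import zify.

Set Implicit Arguments.
Unset Strict Implicit.
Unset Printing Implicit Defensive.

Import Order.TTheory GRing.Theory Num.Theory.

Local Open Scope classical_set_scope.
Local Open Scope ring_scope.

(** Write H and V for the two adjacency relations.  The hypothesis on HV and VH
    says that a horizontal edge followed by a vertical one can be traded for a
    vertical edge followed by a horizontal one with the same end points, and
    conversely.  In the plane, a unit square of which only the bottom and right
    sides are labelled can be completed, and so can one of which only the left
    and top sides are labelled.

    Let x and w be points of X_G.  Place the quadrant of x to the lower left of
    a site (0, 0), the quadrant of w to the upper right of a site (L, 0), and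
    join the two corners by a horizontal walk of length L.  Row 0 is then a
    bi-infinite walk in H.  Above it, the labels on the columns m >= L are
    known, and the rest of the half plane is completed leftwards, one square at
    a time, by the first kind of filling; below it, the labels on the columns
    m <= 0 are known, and the rest is completed rightwards by the second kind.
    This is [glue_corners].  Each new label depends on finitely many labels
    already found, so the plane is filled by a plain recursion, with no
    compactness argument.

    Since neighbourhoods in X_G only see finitely many coordinates
    ([weakly_mixingP]), every such neighbourhood is controlled by a large enough
    quadrant, and it remains to choose the same L for two pairs (x1, w1) and
    (x2, w2).  All the corners are labelled by vertices lying on bi-infinite
    walks of H.  Weak mixing of X_H makes H irreducible on these vertices, and
    aperiodic, in the strong form that every such vertex has closed walks of two
    consecutive lengths; hence two such vertices are joined by walks of all
    large lengths ([mixing_large_walks]), and a common L exists.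

    When X_V is weakly mixing instead, the hypotheses are symmetric and the same
    argument is applied to the transposed configurations. *)

(** * Weak mixing in terms of finite patterns *)

(** [z] witnesses that the shift by [n] of the cylinder around [x] meets the
    cylinder around [w], both cylinders being given by the sites in [s]. *)
Definition connects (A : finType) (K : zmodType) (X : set (config A K))
    (s : seq K) (n : K) (x w : config A K) :=
  exists2 z, X z /\ {in s, forall k, z k = x k} &
             X (shift n z) /\ {in s, forall k, z (k + n) = w k}.

(** The filter generated by the cylinders around [x] converges to [x]
    coordinatewise, hence in the product topology, so it contains every
    neighbourhood of [x]. *)
Lemma open_finite_pattern (A : finType) (K : zmodType) (X U : set (config A K))
    (x : config A K) :
  open_in X U -> U x ->
  exists s : seq K, forall z, X z -> {in s, forall k, z k = x k} -> U z.
Proof.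
move=> [UX /open_subspaceP [V oV VU]] Ux.
have Vx : V x by have [] : (V `&` X) x by rewrite VU; split=> //; exact: UX.
pose F : set_system (config A K) := fun S =>
  exists s : seq K, forall z, {in s, forall k, z k = x k} -> S z.
have FF : Filter F.
  split.
  - by exists [::].
  - move=> P Q [s sP] [t tQ]; exists (s ++ t) => z zx; split.
      by apply: sP => k ks; apply: zx; rewrite mem_cat ks.
    by apply: tQ => k kt; apply: zx; rewrite mem_cat kt orbT.
  - by move=> P Q PQ [s sP]; exists s => z /sP /PQ.
have Fx : F --> x.
  apply: (proj2 (@pointwise_cvgP (discrete_topology K) (discrete_topology A) F x FF)) => k S Sxk; exists [:: k] => z zx /=.
  by rewrite zx ?mem_head//; exact: nbhs_singleton.
have /Fx [s sV] : nbhs x V by exact: open_nbhs_nbhs.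
exists s => z Xz /sV Vz.
by have [] : (U `&` X) z by rewrite -VU.
Qed.

Lemma open_pattern (A : finType) (K : zmodType) (X : set (config A K))
    (s : seq K) (x : config A K) :
  open_in X [set z | X z /\ {in s, forall k, z k = x k}].
Proof.
split=> [z [] //|]; apply/open_subspaceP.
exists [set z : config A K | {in s, forall k, z k = x k}]; last first.
  by apply/seteqP; split => z /=; tauto.
elim: s => [|k s IH].
  have -> : [set z : config A K | {in [::], forall k, z k = x k}] = setT.
    by apply/seteqP; split.
  exact: openT.
have -> : [set z : config A K | {in k :: s, forall k, z k = x k}] =
    proj k @^-1` [set x k] `&` [set z | {in s, forall k, z k = x k}].
  apply/seteqP; split=> [z /= zx|z /= [zk zs]].
    split; first exact: zx (mem_head _ _).
    by move=> l ls; apply: zx; rewrite inE ls orbT.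
  by move=> l; rewrite inE => /predU1P[->//|/zs].
apply: openI => //.
have : continuous (proj k : config A K -> discrete_topology A).
  exact: proj_continuous.
by move/continuousP; apply; exact: discrete_open.
Qed.

(** A single window [s] serves the four open sets, because finitely many finite
    windows can be merged into one. *)
Lemma weakly_mixingP (A : finType) (K : zmodType) (X : set (config A K)) :
  weakly_mixing X <->
  forall s x1 x2 w1 w2, X x1 -> X x2 -> X w1 -> X w2 ->
    exists n, connects X s n x1 w1 /\ connects X s n x2 w2.
Proof.
split=> [wm s x1 x2 w1 w2 X1 X2 Y1 Y2|cX U1 U2 W1 W2 oU1 oU2 oW1 oW2].
  have [||||n [[z1' [[z1 H1 <-] H3]] [z2' [[z2 H2 <-] H4]]]] := wm _ _ _ _
    (open_pattern X s x1) (open_pattern X s x2)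
    (open_pattern X s w1) (open_pattern X s w2).
  - by exists x1.
  - by exists x2.
  - by exists w1.
  - by exists w2.
  by exists n; split; [exists z1|exists z2].
move=> [x1 Ux1] [x2 Ux2] [w1 Ww1] [w2 Ww2].
have [s1 H1] := open_finite_pattern oU1 Ux1.
have [s2 H2] := open_finite_pattern oU2 Ux2.
have [t1 J1] := open_finite_pattern oW1 Ww1.
have [t2 J2] := open_finite_pattern oW2 Ww2.
pose s := (s1 ++ s2) ++ (t1 ++ t2).
have [n [[z1 [? a1] [? b1]] [z2 [? a2] [? b2]]]] := cX s x1 x2 w1 w2
  (proj1 oU1 _ Ux1) (proj1 oU2 _ Ux2) (proj1 oW1 _ Ww1) (proj1 oW2 _ Ww2).
exists n; split.
  exists (shift n z1); split.
    by exists z1 => //; apply: H1 => // k ks; apply: a1; rewrite !mem_cat ks.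
  by apply: J1 => // k ks; apply: b1; rewrite !mem_cat ks !orbT.
exists (shift n z2); split.
  by exists z2 => //; apply: H2 => // k ks; apply: a2; rewrite !mem_cat ks !orbT.
by apply: J2 => // k ks; apply: b2; rewrite !mem_cat ks !orbT.
Qed.

(** * Walks in a graph whose shift is weakly mixing *)

Fixpoint walk (A : Type) (e : rel A) (n : nat) (a b : A) : Prop :=
  if n is n'.+1 then exists2 c, e a c & walk e n' c b else a = b.

Lemma walk_cat (A : Type) (e : rel A) m n a b c :
  walk e m a b -> walk e n b c -> walk e (m + n) a c.
Proof.
elim: m a => [a -> //|m IH a [d ad db] bc]; exists d => //; exact: IH.
Qed.

Lemma walk_iter (A : Type) (e : rel A) k m a :
  walk e m a a -> walk e (k * m) a a.
Proof. by move=> am; elim: k => // k IH; rewrite mulSn; apply: walk_cat IH. Qed.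

Lemma shift1_adjmx (A : finType) (e : rel A) (y : config A int) :
  shift1 (adjmx e) y <-> forall m, e (y m) (y (m + 1)).
Proof.
by split=> ey m; have := ey m; rewrite entry_adjmx; case: (e _ _).
Qed.

Lemma walk_orbit (A : Type) (e : rel A) (y : int -> A) (m : int) (n : nat) :
  (forall m, e (y m) (y (m + 1))) -> walk e n (y m) (y (m + n%:Z)).
Proof.
move=> ey; elim: n m => [|n IH] m /=; first by rewrite addr0.
exists (y (m + 1)) => //; have := IH (m + 1).
by congr walk; congr y; lia.
Qed.

(** The vertices that are visible in the one-dimensional shift of [e]; the graph
    may have others, about which weak mixing of the shift says nothing. *)
Definition essential (A : finType) (e : rel A) (a : A) :=
  exists2 y : int -> A, forall m, e (y m) (y (m + 1)) & y 0 = a.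

Lemma essential_orbit (A : finType) (e : rel A) (y : int -> A) m :
  (forall m, e (y m) (y (m + 1))) -> essential e (y m).
Proof.
move=> ey; exists (fun k => y (m + k)) => [k|]; last by rewrite addr0.
by rewrite addrA.
Qed.

(** The direction of the walks is the sign of the shift provided by weak mixing,
    which cannot be chosen but is the same for both pairs. *)
Lemma mixing_pairs (A : finType) (e : rel A) a1 a2 b1 b2 :
  weakly_mixing (shift1 (adjmx e)) ->
  essential e a1 -> essential e a2 -> essential e b1 -> essential e b2 ->
  exists n, (walk e n a1 b1 /\ walk e n a2 b2) \/
            (walk e n b1 a1 /\ walk e n b2 a2).
Proof.
move=> /weakly_mixingP wm [x1 ex1 <-] [x2 ex2 <-] [w1 ew1 <-] [w2 ew2 <-].
have [||||n [[z1 [/shift1_adjmx ez1 a1'] [_ b1']]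
             [z2 [/shift1_adjmx ez2 a2'] [_ b2']]]] := wm [:: 0] x1 x2 w1 w2;
  try by apply/shift1_adjmx.
have in0 : (0 : int) \in [:: 0] by rewrite mem_head.
rewrite -(a1' _ in0) -(a2' _ in0) -(b1' _ in0) -(b2' _ in0) add0r.
exists `|n|%N; have [n0|n0] := leP 0 n.
  have forth (z : int -> A) : (forall m, e (z m) (z (m + 1))) ->
      walk e `|n|%N (z 0) (z n).
    by move=> ez; have := walk_orbit 0 `|n|%N ez; congr (walk _ _ _ (z _)); lia.
  by left; split; exact: forth.
have back (z : int -> A) : (forall m, e (z m) (z (m + 1))) ->
    walk e `|n|%N (z n) (z 0).
  by move=> ez; have := walk_orbit n `|n|%N ez; congr (walk _ _ _ (z _)); lia.
by right; split; exact: back.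
Qed.

(** Pairing (a, b) with (b, a) makes the unknown direction harmless. *)
Lemma mixing_irreducible (A : finType) (e : rel A) a b :
  weakly_mixing (shift1 (adjmx e)) -> essential e a -> essential e b ->
  exists n, walk e n a b.
Proof.
move=> wm ea eb.
by have [n [[ab _]|[_ ab]]] := mixing_pairs wm ea eb eb ea; exists n.
Qed.

(** Take an edge from [a] to [b] and apply weak mixing to the pairs (a, a) and
    (a, b): a closed walk at [a] and a walk between [a] and [b] have the same
    length [n].  If the latter goes from [b] to [a], the edge closes it into a
    cycle of length [n + 1].  If it goes from [a] to [b], close it by any walk of
    length [r] back to [a], and compare this cycle of length [n + r] with the
    cycle of length [n] followed by the edge and the same walk back. *)
Lemma mixing_consecutive_cycles (A : finType) (e : rel A) a :
  weakly_mixing (shift1 (adjmx e)) -> essential e a ->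
  exists k, walk e k a a /\ walk e k.+1 a a.
Proof.
move=> wm ea.
have [b [eb ab]] : exists b, essential e b /\ walk e 1 a b.
  have [y ey <-] := ea; exists (y 1); split; first exact: essential_orbit.
  by exists (y 1) => //; rewrite -[1]add0r.
have [r br] := mixing_irreducible wm eb ea.
have [n [[aa abn]|[aa ba]]] := mixing_pairs wm ea ea ea eb; last first.
  by exists n; split=> //; exact: walk_cat ab ba.
exists (n + r)%N; split; first exact: walk_cat abn br.
rewrite -addnS -add1n; apply: walk_cat aa _; exact: walk_cat ab br.
Qed.

(** If k > 0, write L = q k + r with r < k <= q and go (q - r) times around
    the short cycle and r times around the long one.  If k = 0, the long cycle is
    a loop. *)
Lemma walk_consecutive (A : Type) (e : rel A) k L a :
  walk e k a a -> walk e k.+1 a a -> (k * k <= L)%N -> walk e L a a.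
Proof.
case: k => [_ a1 _|k ak ak1 kL]; first by rewrite -[L]muln1; exact: walk_iter.
have qk : (k.+1 <= L %/ k.+1)%N by rewrite leq_divRL.
have rk : (L %% k.+1 < k.+1)%N by rewrite ltn_mod.
have -> : L = ((L %/ k.+1 - L %% k.+1) * k.+1 + (L %% k.+1) * k.+2)%N.
  rewrite {1}(divn_eq L k.+1); nia.
by apply: walk_cat; exact: walk_iter.
Qed.

Lemma mixing_large_walks (A : finType) (e : rel A) a b :
  weakly_mixing (shift1 (adjmx e)) -> essential e a -> essential e b ->
  exists N, forall L, (N <= L)%N -> walk e L a b.
Proof.
move=> wm ea eb; have [p ap] := mixing_irreducible wm ea eb.
have [k [ak ak1]] := mixing_consecutive_cycles wm ea.
exists (k * k + p)%N => L NL.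
have -> : L = ((L - p) + p)%N by lia.
by apply: walk_cat ap; apply: walk_consecutive ak ak1 _; lia.
Qed.

Lemma mixing_common_length (A : finType) (e : rel A) a1 a2 b1 b2 :
  weakly_mixing (shift1 (adjmx e)) ->
  essential e a1 -> essential e a2 -> essential e b1 -> essential e b2 ->
  exists L, walk e L a1 b1 /\ walk e L a2 b2.
Proof.
move=> wm ea1 ea2 eb1 eb2.
have [N1 H1] := mixing_large_walks wm ea1 eb1.
have [N2 H2] := mixing_large_walks wm ea2 eb2.
by exists (maxn N1 N2); split; [apply: H1|apply: H2]; lia.
Qed.

(** * Filling corners *)

(** The square with bottom side [a -> b] and right side [b -> d] gets the upper
    left corner [e].  Exchanging [h] and [v] gives the filling of the lower right
    corner from the left and top sides. *)
Definition fills (A : Type) (h v : rel A) :=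
  forall a b d, h a b -> v b d -> exists e, v a e /\ h e d.

Definition tiling (A : Type) (h v : rel A) (x : int -> int -> A) :=
  forall m n, h (x m n) (x (m + 1) n) /\ v (x m n) (x m (n + 1)).

(** [q j n] is the label [j] columns to the left of the column [c] and [n] rows
    above the row [r]; it is computed row by row, and along each row leftwards. *)
Lemma fill_quadrant (A : finType) (h v : rel A) (r c : nat -> A) :
  fills h v -> r 0%N = c 0%N ->
  (forall j, h (r j.+1) (r j)) -> (forall n, v (c n) (c n.+1)) ->
  exists q : nat -> nat -> A,
    [/\ forall j, q j 0%N = r j, forall n, q 0%N n = c n,
        forall j n, h (q j.+1 n) (q j n) & forall j n, v (q j n) (q j n.+1)].
Proof.
move=> hv rc hr vc.
(* The upper left corner of a square depends on the two corners next to it. *)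
pose phi a d := odflt a [pick e | v a e && h e d].
have phiP a b d : h a b -> v b d -> v a (phi a d) /\ h (phi a d) d.
  move=> ab bd; rewrite /phi; case: pickP => [e /andP[]//|none].
  by have [e [ae ed]] := hv _ _ _ ab bd; have := none e; rewrite ae ed.
pose next (p : nat -> A) a := nat_rect (fun=> A) a (fun j d => phi (p j.+1) d).
pose row := nat_rect (fun=> nat -> A) r (fun n p => next p (c n.+1)).
have nextP p n : p 0%N = c n -> (forall j, h (p j.+1) (p j)) ->
    forall j, v (p j) (next p (c n.+1) j).
  move=> p0 hp; elim=> [|j IH]; first by rewrite p0; exact: vc.
  by case: (phiP _ _ _ (hp j) IH).
have rowP n : row n 0%N = c n /\ forall j, h (row n j.+1) (row n j).
  elim: n => [|n [r0 hn]]; split=> // j.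
  by case: (phiP _ _ _ (hn j) (nextP _ _ r0 hn j)).
exists (fun j n => row n j); split=> [//|n|j n|j n].
- exact: (rowP n).1.
- exact: (rowP n).2.
- exact: nextP (rowP n).1 (rowP n).2 j.
Qed.

Lemma fill_halfplane (A : finType) (h v : rel A) (y : int -> A)
    (w : int -> int -> A) :
  fills h v -> (forall m, h (y m) (y (m + 1))) -> tiling h v w ->
  (forall m, 0 <= m -> y m = w m 0) ->
  exists z : int -> nat -> A,
    [/\ forall m, z m 0%N = y m,
        forall m n, 0 <= m -> z m n = w m n%:Z,
        forall m n, h (z m n) (z (m + 1) n) &
        forall m n, v (z m n) (z m n.+1)].
Proof.
move=> hv hy tw yw.
have [|||q [q0 qc hq vq]] := @fill_quadrant _ h v
  (fun j => y (- j%:Z)) (fun n => w 0 n%:Z) hv.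
- by rewrite oppr0 yw.
- by move=> j; have := hy (- j.+1%:Z); congr (h _ (y _)); lia.
- by move=> n; have := (tw 0 n%:Z).2; congr (v _ (w _ _)); lia.
pose z m n := if 0 <= m then w m n%:Z else q `|m|%N n.
have zpos (j n : nat) : z j n = w j n by [].
have zneg (j n : nat) : z (- j%:Z) n = q j n.
  by case: j => [|j]; rewrite /z ?qc.
exists z; split=> [m|m n m0|m n|m n].
- by rewrite /z; case: ifP => m0; [rewrite yw|rewrite q0; congr y; lia].
- by rewrite /z m0.
- case: m => m; first by rewrite -PoszD !zpos PoszD; exact: (tw _ _).1.
  rewrite NegzE (_ : - m.+1%:Z + 1 = - m%:Z); last by lia.
  by rewrite !zneg.
- case: m => m; last by rewrite NegzE !zneg.
  by rewrite !zpos -addn1 PoszD; exact: (tw _ _).2.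
Qed.

(** Only the left half of [x] is assumed to be a walk, so that the induction on
    the length can absorb the first step of the walk into that half. *)
Lemma splice_rows (A : Type) (h : rel A) (x w : int -> A) (L : nat) :
  (forall m, m < 0 -> h (x m) (x (m + 1))) -> (forall m, h (w m) (w (m + 1))) ->
  walk h L (x 0) (w 0) ->
  exists y : int -> A,
    [/\ forall m, h (y m) (y (m + 1)), forall m, m <= 0 -> y m = x m &
        forall m, 0 <= m -> y (m + L%:Z) = w m].
Proof.
move=> hx hw; elim: L x hx => [|L IH] x hx.
  move=> /= xw; exists (fun m => if m < 0 then x m else w m).
  split=> [m|m m0|m m0]; last first.
  - by rewrite addr0 ltNge m0.
  - by case: ltP => // m0'; rewrite (_ : m = 0) //; lia.
  case: (ltP m 0) => m0; last by rewrite ltNge (_ : 0 <= m + 1) //; lia.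
  have := hx m m0; case: ltP => // m1.
  by rewrite (_ : m + 1 = 0) ?xw //; lia.
move=> [c xc cw].
have [||y [hy yx yw]] := IH (fun m => if m < 0 then x (m + 1) else c).
- move=> m m0; rewrite m0; case: ltP => m1; first by apply: hx.
  by rewrite (_ : m + 1 = 0) //; lia.
- by [].
exists (fun m => y (m - 1)); split=> [m|m m0|m m0].
- by have := hy (m - 1); rewrite addrAC.
- by rewrite yx ?subrK ?ifT //; lia.
- by rewrite -yw //; congr y; lia.
Qed.

(** The lower half plane is the upper one for the reversed relations, after a
    rotation of the plane by a half turn: this is where the second filling
    property is used.  The half turn is centred at (0, 0) whereas the upper half
    plane is translated by [L]. *)
Lemma glue_corners (A : finType) (h v : rel A) (x w : int -> int -> A) (L : nat) :
  fills h v -> fills v h -> tiling h v x -> tiling h v w ->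
  walk h L (x 0 0) (w 0 0) ->
  exists2 z, tiling h v z &
    (forall m n, m <= 0 -> n <= 0 -> z m n = x m n) /\
    (forall m n, 0 <= m -> 0 <= n -> z (m + L%:Z) n = w m n).
Proof.
move=> hv vh tx tw xw.
have [||y [hy yx yw]] := @splice_rows _ h (x^~ 0) (w^~ 0) L _ _ xw.
- by move=> m _; exact: (tx _ _).1.
- by move=> m; exact: (tw _ _).1.
have [|||zu [zu0 zuw hu vu]] := @fill_halfplane _ h v (fun m => y (m + L%:Z)) w hv.
- by move=> m; have := hy (m + L%:Z); rewrite addrAC.
- by [].
- exact: yw.
have [||||zd [zd0 zdx hd vd]] := @fill_halfplane _ (fun a b => h b a)
  (fun a b => v b a) (fun m => y (- m)) (fun m n => x (- m) (- n)).
- by move=> a b d ba db; have [e [de ea]] := vh _ _ _ db ba; exists e.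
- by move=> m; have := hy (- (m + 1)); congr (h _ (y _)); lia.
- move=> m n; split.
    by have := (tx (- (m + 1)) (- n)).1; congr (h _ (x _ _)); lia.
  by have := (tx (- m) (- (n + 1))).2; congr (v _ (x _ _)); lia.
- by move=> m m0; rewrite oppr0 yx //; lia.
pose z m n := match n with
  | Posz k => zu (m - L%:Z) k | Negz k => zd (- m) k.+1 end.
(* The two half planes share row 0, so either description may be used there. *)
have zE m k : z m (- k%:Z) = zd (- m) k.
  case: k => [|//]; have -> : z m (- 0%N%:Z) = zu (m - L%:Z) 0%N by [].
  by rewrite zu0 zd0 subrK opprK.
exists z.
  move=> m [] n; split.
  - by have := hu (m - L%:Z) n; rewrite /z addrAC.
  - by rewrite -PoszD addn1 /z.
  - by have := hd (- (m + 1)) n.+1; rewrite /z (_ : - (m + 1) + 1 = - m); last lia.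
  - rewrite NegzE (_ : - n.+1%:Z + 1 = - n%:Z); last lia.
    by rewrite !zE.
split=> m n m0 n0.
  rewrite (_ : n = - `|n|%N%:Z) ?zE ?zdx ?opprK //; lia.
by case: n n0 => // n _; rewrite /z addrK zuw.
Qed.

(** The corners being (N, N) for [x] and (-N, -N) for [w], the two quadrants
    contain any prescribed finite pattern once N is large.  The offset (a, b) is
    kept in the definition because two pairs must be glued with the same one. *)
Definition glues (A : Type) (h v : rel A) (N : nat) (a b : int)
    (x w : int -> int -> A) :=
  exists2 z, tiling h v z &
    (forall m n, m <= N%:Z -> n <= N%:Z -> z m n = x m n) /\
    (forall m n, - N%:Z <= m -> - N%:Z <= n -> z (m + a) (n + b) = w m n).

Lemma glue_quadrants (A : finType) (h v : rel A) (x w : int -> int -> A)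
    (N L : nat) :
  fills h v -> fills v h -> tiling h v x -> tiling h v w ->
  walk h L (x N N) (w (- N%:Z) (- N%:Z)) ->
  glues h v N (N + N + L)%N (N + N)%N x w.
Proof.
move=> hv vh tx tw xw.
have [|||z tz [zx zw]] := @glue_corners _ h v (fun m n => x (m + N%:Z) (n + N%:Z))
  (fun m n => w (m - N%:Z) (n - N%:Z)) L hv vh.
- by move=> m n; rewrite -(addrAC m) -(addrAC n); exact: tx.
- by move=> m n; rewrite -(addrAC m) -(addrAC n); exact: tw.
- by rewrite !add0r.
exists (fun m n => z (m - N%:Z) (n - N%:Z)).
  by move=> m n; rewrite -(addrAC m) -(addrAC n); exact: tz.
split=> m n mN nN; first by rewrite zx ?subrK //; lia.
have := zw (m + N%:Z) (n + N%:Z); rewrite !addrK => <-; try lia.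
by congr z; lia.
Qed.

Lemma tiling_transpose (A : Type) (h v : rel A) (x : int -> int -> A) :
  tiling h v x -> tiling v h (fun m n => x n m).
Proof. by move=> tx m n; have [] := tx n m. Qed.

Lemma glues_transpose (A : Type) (h v : rel A) N a b (x w : int -> int -> A) :
  glues v h N a b (fun m n => x n m) (fun m n => w n m) -> glues h v N b a x w.
Proof.
move=> [z tz [zx zw]]; exists (fun m n => z n m); first exact: tiling_transpose.
by split=> m n ? ?; [rewrite zx|rewrite zw].
Qed.

Lemma tiling_essential (A : finType) (h v : rel A) (x : int -> int -> A) m n :
  tiling h v x -> essential h (x m n).
Proof. by move=> tx; apply: (essential_orbit (y := x^~ n)) => k; case: (tx k n). Qed.

Lemma glue_pairs (A : finType) (h v : rel A) (x1 x2 w1 w2 : int -> int -> A)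
    (N : nat) :
  fills h v -> fills v h -> weakly_mixing (shift1 (adjmx h)) ->
  tiling h v x1 -> tiling h v x2 -> tiling h v w1 -> tiling h v w2 ->
  exists a b, glues h v N a b x1 w1 /\ glues h v N a b x2 w2.
Proof.
move=> hv vh wm tx1 tx2 tw1 tw2.
have [L [W1 W2]] := mixing_common_length wm
  (tiling_essential N N tx1) (tiling_essential N N tx2)
  (tiling_essential (- N%:Z) (- N%:Z) tw1) (tiling_essential (- N%:Z) (- N%:Z) tw2).
by exists (N + N + L)%N%:Z, (N + N)%N%:Z; split; exact: glue_quadrants.
Qed.

(** * The two-dimensional shift *)

Lemma entry_mul_adjmx (A : finType) (e f : rel A) (i j : A) :
  entry (adjmx e *m adjmx f) i j <> 0 <-> exists k, e i k /\ f k j.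
Proof.
rewrite /entry mxE; under eq_bigr do rewrite !mxE !enum_rankK -natrM.
rewrite -natr_sum; split.
  move=> /eqP; rewrite pnatr_eq0 sum_nat_eq0 negb_forall => /existsP[k].
  rewrite muln_eq0 negb_or !eqb0 !negbK => /andP[ik kj].
  by exists (enum_val k).
move=> [k [ik kj]]; apply/eqP.
rewrite pnatr_eq0 sum_nat_eq0 negb_forall; apply/existsP.
by exists (enum_rank k); rewrite enum_rankK ik kj.
Qed.

Lemma shift2_tiling (A : finType) (G : graph2 A)
    (x : config A (int * int)%type) :
  shift2 G x <-> tiling (hedge G) (vedge G) (fun m n => x (m, n)).
Proof.
split=> Gx m n; have [] := Gx m n; rewrite !entry_adjmx;
  by case: (hedge _ _ _) => //; case: (vedge _ _ _).
Qed.

Lemma bounded_support (s : seq (int * int)) :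
  exists N : nat, {in s, forall k,
    [/\ - N%:Z <= k.1, k.1 <= N%:Z, - N%:Z <= k.2 & k.2 <= N%:Z]}.
Proof.
exists (\max_(k <- s) maxn `|k.1| `|k.2|)%N => k ks.
have := @leq_bigmax_seq _ s xpredT (fun k => maxn `|k.1| `|k.2|)%N k ks isT.
by move: (bigop.body _ _ _) => M /=; case: k ks => a b _ /= abM; split; lia.
Qed.

Lemma glues_connects (A : finType) (G : graph2 A) (N : nat) (a b : int)
    (s : seq (int * int)) (x w : config A (int * int)%type) :
  {in s, forall k, [/\ - N%:Z <= k.1, k.1 <= N%:Z, - N%:Z <= k.2 & k.2 <= N%:Z]} ->
  glues (hedge G) (vedge G) N a b (fun m n => x (m, n)) (fun m n => w (m, n)) ->
  connects (shift2 G) s (a, b) x w.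
Proof.
move=> sN [z tz [zx zw]]; exists (fun k => z k.1 k.2); split.
- exact/shift2_tiling.
- by move=> [m n] /sN [*]; apply: zx.
- apply/shift2_tiling => m n; rewrite /shift /=.
  by rewrite -(addrAC m) -(addrAC n); exact: tz.
- by move=> [m n] /sN [*]; apply: zw.
Qed.

Theorem corollary1 (A : finType) (G : graph2 A)
    (subshift_G : is_subshift (shift2 G))
    (HV_VH : forall i j : A,
       entry (hmx G *m vmx G) i j <> 0 <-> entry (vmx G *m hmx G) i j <> 0)
    (wm : weakly_mixing (shift1 (hmx G)) \/ weakly_mixing (shift1 (vmx G))) :
  weakly_mixing (shift2 G).
Proof.
have hv : fills (hedge G) (vedge G).
  move=> a b d ab bd; apply/entry_mul_adjmx/HV_VH/entry_mul_adjmx.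
  by exists b.
have vh : fills (vedge G) (hedge G).
  move=> a b d ab bd; apply/entry_mul_adjmx/HV_VH/entry_mul_adjmx.
  by exists b.
apply/weakly_mixingP => s x1 x2 w1 w2 /shift2_tiling tx1 /shift2_tiling tx2
  /shift2_tiling tw1 /shift2_tiling tw2.
have [N sN] := bounded_support s.
have [a [b [g1 g2]]] : exists a b,
    glues (hedge G) (vedge G) N a b (fun m n => x1 (m, n)) (fun m n => w1 (m, n)) /\
    glues (hedge G) (vedge G) N a b (fun m n => x2 (m, n)) (fun m n => w2 (m, n)).
  case: wm => wm; first exact: glue_pairs.
  have [b [a [g1 g2]]] := glue_pairs N vh hv wm
    (tiling_transpose tx1) (tiling_transpose tx2)
    (tiling_transpose tw1) (tiling_transpose tw2).
  by exists a, b; split; exact: glues_transpose.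
by exists (a, b); split; exact: glues_connects sN _.
Qed.
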